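(* Let \[\gamma = \frac{1}{2}+\frac{\log_{65}7}{3}+\frac{\log_{65}17}{6} = 0.7685\dots.\] For every $\varepsilon>0$ there is a constant $c_\varepsilon>0$ such that for every positive integer $N$ there exists a set $A\subseteq[N]$ containing no non-trivial configuration of the form $\{x,x+y,x+y^2\}$ and satisfying $|A|\geq c_\varepsilon N^{\gamma-\varepsilon}$.
   Context: $[N]=\{1,2,\dots,N\}$. A configuration $\{x,x+y,x+y^2\}$ in $A$ means integers $x,y$ with $x$, $x+y$, $x+y^2$ all in $A$; it is non-trivial if $y\in\mathbb{Z}\setminus\{0\}$. *)

(* Defs.v *)
From HB Require Import structures.
From mathcomp Require Import all_boot all_order all_algebra.
From mathcomp Require Import finmap.
From mathcomp Require Import reals exp.

Set Implicit Arguments.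
Unset Strict Implicit.
Unset Printing Implicit Defensive.

Import Order.TTheory GRing.Theory Num.Theory.

Local Open Scope ring_scope.

Definition logb (R : realType) (b x : R) : R := ln x / ln b.

Definition gamma (R : realType) : R :=
  1 / 2 + logb 65 7 / 3 + logb 65 17 / 6.

(* The three points need not be distinct: y = 1 gives x + y = x + y ^ 2, so a
   set without such configurations contains no two consecutive integers. *)
Definition has_nontrivial_config (A : {fset int}) : Prop :=
  exists x y : int, [/\ y != 0, x \in A, x + y \in A & x + y ^+ 2 \in A].

(* Main.v *)
(* Restrict the base 65 digits of the elements, the digit at position j being
   free for j odd, in a 7-element set S when the 2-adic valuation of j is odd, in
   a 17-element set T when it is even and positive, and 0 at position 0.  If y is
   65 ^ k * z with z not divisible by 65, then x and x + y differ by z mod 65 at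
   position k, while x and x + y ^ 2 differ by z ^ 2 mod 65 at position 2k.  The
   sets are chosen so that no two elements of S differ by the square of a nonzero
   residue, and no two elements of T by the square of a nonzero difference of
   elements of S; hence the digits at k and 2k cannot both be admissible.  The
   positions with 65, 7 and 17 digits have densities 1/2, 1/3 and 1/6, which
   gives the exponent gamma. *)
Require Import Defs.
From HB Require Import structures.
From mathcomp Require Import all_boot all_order all_algebra.
From mathcomp Require Import finmap.
From mathcomp Require Import reals exp.
From mathcomp Require Import sequences zify ring lra.

Set Implicit Arguments.
Unset Strict Implicit.
Unset Printing Implicit Defensive.

Import Order.TTheory GRing.Theory Num.Theory.

Local Open Scope ring_scope.

(** * Residues modulo 65 and admissible digits *)

(* [res7] and [res17] are the sets S and T, found by computer search. *)
Definition res7 : seq nat := [:: 0; 2; 5; 24; 43; 46; 48]%N.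

Definition res17 : seq nat :=
  [:: 0; 5; 10; 15; 20; 21; 26; 31; 32; 37; 42; 43; 48; 53; 54; 59; 64]%N.

Lemma res7_square_free (u r : nat) : u \in res7 -> (0 < r < 65)%N ->
  ((u + r ^ 2) %% 65)%N \notin res7.
Proof.
move=> ures /andP[r0 r65].
have /allP/(_ u ures)/allP/(_ r) : all (fun u => all (fun r =>
  ((u + r ^ 2) %% 65)%N \notin res7) (iota 1 64)) res7 by vm_compute.
by apply; rewrite mem_iota; lia.
Qed.

Lemma res7_res17 (u p r : nat) : u \in res7 -> p \in res17 -> (0 < r < 65)%N ->
  ((u + r) %% 65)%N \in res7 -> ((p + r ^ 2) %% 65)%N \notin res17.
Proof.
move=> ures pres /andP[r0 r65].
have /allP/(_ u ures)/allP/(_ p pres)/allP/(_ r) : all (fun u => all (fun p =>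
  all (fun r => (((u + r) %% 65)%N \in res7) ==>
    (((p + r ^ 2) %% 65)%N \notin res17)) (iota 1 64)) res17) res7 by vm_compute.
by move=> H; apply/implyP/H; rewrite mem_iota; lia.
Qed.

Lemma logn2_double (k : nat) : (0 < k)%N -> logn 2 (2 * k) = (logn 2 k).+1.
Proof. by move=> k0; rewrite lognM // (@logn_prime 2 2). Qed.

Lemma logn2_odd (k : nat) : odd k -> logn 2 k = 0%N.
Proof. by move=> kodd; rewrite lognE dvdn2 kodd andbF. Qed.

Definition digits (j : nat) : seq nat :=
  if j == 0%N then [:: 0%N]
  else if odd j then iota 0 65
  else if odd (logn 2 j) then res7 else res17.

Lemma digits_lt (j d : nat) : d \in digits j -> (d < 65)%N.
Proof.
have H s : all (fun d => (d < 65)%N) s -> d \in s -> (d < 65)%N by move/allP; apply.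
by rewrite /digits; do 3?[case: ifP => _]; apply: H; vm_compute.
Qed.

Lemma digits_uniq (j : nat) : uniq (digits j).
Proof. by rewrite /digits; do 3?[case: ifP => _]; vm_compute. Qed.

Lemma digits0 (j : nat) : (0 \in digits j)%N.
Proof. by rewrite /digits; do 3?[case: ifP => _]; vm_compute. Qed.

(** Doubling raises the 2-adic valuation by one. For [k > 0] of even valuation, position [2 * k]
    carries [res7], which excludes square shifts whatever the digit at [k]. For odd valuation, [k]
    carries [res7] and [2 * k] carries [res17], so the joint condition applies. At [k = 0] the
    forced digit 0 excludes a nonzero shift. *)
Lemma digits_double (k u p r : nat) : u \in digits k -> p \in digits (2 * k) ->
    (0 < r < 65)%N -> ((u + r) %% 65)%N \in digits k ->
  ((p + r ^ 2) %% 65)%N \notin digits (2 * k).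
Proof.
rewrite /digits; case: (eqVneq k 0%N) => [_|k0].
  rewrite !inE => /eqP-> _ /andP[r0 r65]; rewrite add0n modn_small //; lia.
have -> : (2 * k == 0)%N = false by lia.
rewrite oddM /= logn2_double //=; last by lia.
case: (boolP (odd k)) => kodd.
  by rewrite logn2_odd // => _ pk r65 _; exact: (res7_square_free pk r65).
case: (odd (logn 2 k)) => /= uk pk r65 urk; last exact: (res7_square_free pk r65).
exact: res7_res17 uk pk r65 urk.
Qed.

(** * Integers with restricted base 65 digits *)

Fixpoint digitset (n : nat) : seq nat :=
  if n is n'.+1 then
    [seq (a + d * 65 ^ n')%N | a <- digitset n', d <- digits n']
  else [:: 0%N].

Lemma digitset_lt (n a : nat) : a \in digitset n -> (a < 65 ^ n)%N.
Proof.
elim: n a => [|n IH] a /=; first by rewrite inE => /eqP->.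
move=> /allpairsP[[b d] /= [/IH bn /digits_lt dn ->]].
rewrite expnS; nia.
Qed.

(** Digits at positions [j >= n] are 0, which is admissible everywhere; hence [2 * k] may later
    exceed the length [n]. *)
Lemma digitset_digit (n a j : nat) : a \in digitset n ->
  (a %/ 65 ^ j %% 65)%N \in digits j.
Proof.
elim: n a => [|n IH] a /=.
  by rewrite inE => /eqP->; rewrite div0n mod0n digits0.
move=> /allpairsP[[b d] /= [bn dn ->]].
have blt := digitset_lt bn; have dlt := digits_lt dn.
have p0 i : (0 < 65 ^ i)%N by rewrite expn_gt0.
case: (ltngtP j n) => [jn|nj|->].
- have -> : (d * 65 ^ n = d * 65 ^ (n - j.+1) * 65 * 65 ^ j)%N.
    by rewrite -!mulnA -expnS -expnD subnK.
  by rewrite addnC divnMDl // modnMDl IH.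
- rewrite divn_small ?mod0n ?digits0 //.
  apply: leq_trans (_ : 65 ^ n.+1 <= _)%N; last by rewrite leq_pexp2l.
  by rewrite expnS; nia.
- by rewrite addnC divnMDl // divn_small // addn0 modn_small.
Qed.

Lemma digitset_uniq (n : nat) : uniq (digitset n).
Proof.
elim: n => [//|n IH] /=; apply: allpairs_uniq => //; first exact: digits_uniq.
move=> [a d] [b e] /allpairsP[[a' d'] /= [/digitset_lt an _ [-> ->]]].
move=> /allpairsP[[b' e'] /= [/digitset_lt bn _ [-> ->]]] /= E.
have p0 : (0 < 65 ^ n)%N by rewrite expn_gt0.
have dd : d' = e'.
  have := congr1 (divn^~ (65 ^ n)%N) E.
  by rewrite ![(_ + _ * _)%N]addnC !divnMDl // !divn_small // !addn0.
by move: E; rewrite dd => /addIn ->.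
Qed.

Lemma size_digitset (n : nat) :
  size (digitset n) = (\prod_(j < n) size (digits j))%N.
Proof.
elim: n => [|n IH]; first by rewrite big_ord0.
by rewrite big_ord_recr /= size_allpairs IH.
Qed.

(** * Absence of configurations *)

Lemma int_val65 (y : int) : y != 0 ->
  exists (k : nat) (z : int), y = z * (65 ^ k)%N%:Z /\ (z %% 65)%Z != 0.
Proof.
have [m] := ubnP `|y|%N; elim: m y => [//|m IH] y ym y0.
case: (eqVneq (y %% 65)%Z 0) => [/dvdz_mod0P/dvdzP[w yw]|yn]; last first.
  by exists 0%N, y; rewrite expn0 mulr1.
have [||k [z [wz zn]]] := IH w; [lia|lia|].
by exists k.+1, z; split=> //; rewrite yw wz expnS; lia.
Qed.

(** Adding a multiple of [65 ^ k] leaves the lower digits alone, so no carry reaches position [k].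
    Reducing [z] modulo 65 also handles negative [z]. *)
Lemma digit_shift (a b k : nat) (z : int) :
    b%:Z = a%:Z + z * (65 ^ k)%N%:Z ->
  (b %/ 65 ^ k %% 65 = (a %/ 65 ^ k %% 65 + `|(z %% 65)%Z|) %% 65)%N.
Proof.
move=> E; have p0 : (0 < 65 ^ k)%N by rewrite expn_gt0.
have : (b %/ (65 ^ k)%N)%Z = z + (a %/ (65 ^ k)%N)%Z.
  by rewrite E addrC divzMDl //; lia.
rewrite !divz_nat; lia.
Qed.

Lemma absz_modz_sqr (p : nat) (z : int) :
  ((p + `|(z ^+ 2 %% 65)%Z|) %% 65 = (p + `|(z %% 65)%Z| ^ 2) %% 65)%N.
Proof.
rewrite -modnDmr -[RHS]modnDmr -(@modzXm 2 z 65).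
have : (0 <= z %% 65)%Z by lia.
by case: (z %% 65)%Z => // r _; rewrite expr2 -PoszM mulnn modz_nat !absz_nat modn_mod.
Qed.

Lemma digitset_no_config (n : nat) (a b c : nat) (y : int) :
    a \in digitset n -> b \in digitset n -> c \in digitset n ->
  y != 0 -> b%:Z = a%:Z + y -> c%:Z = a%:Z + y ^+ 2 -> False.
Proof.
move=> an bn cn /int_val65[k [z [-> zn]]] bE cE.
have r65 : (0 < `|(z %% 65)%Z| < 65)%N by lia.
have := digitset_digit k bn; rewrite (digit_shift bE).
have := digitset_digit (2 * k) cn; rewrite (@digit_shift a c _ (z ^+ 2)); last first.
  by rewrite cE exprMn mulnC expnM -mulnn PoszM.
move=> H /(digits_double (digitset_digit k an) (digitset_digit (2 * k) an) r65)/negP.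
by apply; rewrite -absz_modz_sqr.
Qed.

(** * Cardinality of the digit sets *)

(* The indices of 1..n with odd 2-adic valuation: halving the even ones flips
   parity, so f(n) = n/2 - f(n/2), whence f(n) = n/3 + O(log n). *)
Definition nval_odd (n : nat) : nat := (\sum_(1 <= j < n.+1) odd (logn 2 j))%N.

Lemma nval_oddS n : nval_odd n.+1 = (nval_odd n + odd (logn 2 n.+1))%N.
Proof. by rewrite /nval_odd big_nat_recr. Qed.

(** The bound is carried along because the induction needs the truncated subtraction to be exact. *)
Lemma nval_odd_double n : nval_odd (2 * n) = (n - nval_odd n)%N /\ (nval_odd n <= n)%N.
Proof.
elim: n => [|n [IH le]]; first by rewrite /nval_odd !big_nil.
have -> : (2 * n.+1 = (2 * n).+2)%N by lia.
rewrite !nval_oddS IH.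
have -> : ((2 * n).+2 = 2 * n.+1)%N by lia.
rewrite logn2_double //= (@logn2_odd (2 * n).+1) ?oddS ?oddM //=.
by case: (odd (logn 2 n.+1)) => /=; lia.
Qed.

Lemma nval_odd_half n :
  nval_odd n = (n %/ 2 - nval_odd (n %/ 2))%N /\ (nval_odd (n %/ 2) <= n %/ 2)%N.
Proof.
have [E le] := nval_odd_double (n %/ 2)%N; split=> //; rewrite -E.
have [->|->] : (n = 2 * (n %/ 2) \/ n = (2 * (n %/ 2)).+1)%N by lia.
  by congr nval_odd; lia.
by rewrite nval_oddS logn2_odd ?oddS ?oddM // addn0; congr nval_odd; lia.
Qed.

(** Each halving flips the sign of the error and adds at most 1 to it, through the rounding of
    [n %/ 2]; [l] counts the halvings. *)
Lemma nval_odd_bound l n : (n < 2 ^ l)%N ->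
  (3 * nval_odd n <= n + l)%N /\ (n <= 3 * nval_odd n + l)%N.
Proof.
elim: l n => [|l IH] n.
  by case: n => // _; rewrite /nval_odd big_nil.
rewrite expnS => nl.
have [|IH1 IH2] := IH (n %/ 2)%N; first by lia.
have [E le] := nval_odd_half n.
lia.
Qed.

(** Position 0 contributes a factor 1, so only positions 1 to [n] count. *)
Lemma size_digitsetS n : size (digitset n.+1) =
  (65 ^ (n - n %/ 2) * (7 ^ nval_odd n * 17 ^ (n %/ 2 - nval_odd n)))%N.
Proof.
elim: n => [|n IH]; first by rewrite size_digitset big_ord1 /nval_odd big_nil.
rewrite size_digitset big_ord_recr /= -size_digitset IH {IH} nval_oddS.
have le m : (nval_odd m <= m %/ 2)%N by have [-> _] := nval_odd_half m; lia.
have := le n; have := le n.+1; rewrite nval_oddS.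
rewrite /digits /=; case: (boolP (odd n)) => /= [on|en].
  have -> : (n.+1 %/ 2 = (n %/ 2).+1)%N by lia.
  have -> : (n.+1 - (n %/ 2).+1 = n - n %/ 2)%N by lia.
  case: (odd (logn 2 n.+1)) => /= h1 h2.
    rewrite addn1 expnS subSS; ring.
  rewrite addn0 subSn // expnS; ring.
have -> : (n.+1 %/ 2 = n %/ 2)%N by lia.
have -> : (n.+1 - n %/ 2 = (n - n %/ 2).+1)%N by lia.
rewrite logn2_odd ?oddS // addn0 => _ _; rewrite expnS; ring.
Qed.

(** * Logarithmic estimates *)

Section RealBounds.
Variable R : realType.

Lemma ler_ln_nat (a b : nat) : (0 < a)%N -> (a <= b)%N ->
  ln (a%:R : R) <= ln b%:R.
Proof. by move=> a0 ab; rewrite ler_ln ?posrE ?ltr0n ?ler_nat //; lia. Qed.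

Lemma ltr_ln_nat (a b : nat) : (0 < a)%N -> (a < b)%N ->
  ln (a%:R : R) < ln b%:R.
Proof. by move=> a0 ab; rewrite ltr_ln ?posrE ?ltr0n ?ltr_nat //; lia. Qed.

Lemma ln_natM (a b : nat) : (0 < a)%N -> (0 < b)%N ->
  ln ((a * b)%N%:R : R) = ln a%:R + ln b%:R.
Proof. by move=> a0 b0; rewrite natrM lnM // posrE ltr0n. Qed.

Lemma ln_natX (a k : nat) : (0 < a)%N -> ln ((a ^ k)%N%:R : R) = k%:R * ln a%:R.
Proof. by move=> a0; rewrite natrX lnXn ?ltr0n // mulr_natl. Qed.

Lemma ln65_gt0 : 0 < ln (65%:R : R).
Proof. by rewrite ln_gt0 // ltr1n. Qed.

Lemma gamma_ln65 :
  gamma R * ln 65%:R = ln 65%:R / 2 + ln 7%:R / 3 + ln 17%:R / 6.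
Proof.
rewrite /gamma /logb; have := ln65_gt0.
move: (ln 65%:R) (ln 7%:R) (ln 17%:R) => L A B L0.
by field; lra.
Qed.

Lemma ln833 : ln (833%:R : R) = 2 * ln 7%:R + ln 17%:R.
Proof. by rewrite (_ : 833 = 7 ^ 2 * 17)%N // ln_natM // ln_natX. Qed.

Lemma ltr_ln_natX (a b i j : nat) : (0 < a)%N -> (0 < b)%N ->
  (a ^ i < b ^ j)%N -> i%:R * ln (a%:R : R) < j%:R * ln b%:R.
Proof. by move=> a0 b0 h; rewrite -!ln_natX // ltr_ln_nat ?expn_gt0 ?a0. Qed.

Lemma ler_ln_natXM (a b c d i j k l : nat) :
    (0 < a)%N -> (0 < b)%N -> (0 < c)%N -> (0 < d)%N ->
    (a ^ i * b ^ j <= c ^ k * d ^ l)%N ->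
  i%:R * ln (a%:R : R) + j%:R * ln b%:R <= k%:R * ln c%:R + l%:R * ln d%:R.
Proof.
move=> a0 b0 c0 d0 h; rewrite -!ln_natX // -!ln_natM ?expn_gt0 ?a0 ?b0 ?c0 ?d0 //.
by rewrite ler_ln_nat // muln_gt0 !expn_gt0 a0 b0.
Qed.

Lemma ln833_lt : 18%:R * ln (833%:R : R) < 29%:R * ln 65%:R.
Proof. by apply: ltr_ln_natX; lia. Qed.

(* ln 833 / ln 65 = 1.61102...; inserting 126/125, a bound for 65^29/833^18,
   avoids comparing the huge integers 65^820 and 833^509. *)
Lemma ln833_ge : 820%:R * ln (65%:R : R) <= 509%:R * ln 833%:R.
Proof.
have h1 : 29%:R * ln 65%:R + 1%:R * ln 125%:R <=
    18%:R * ln 833%:R + 1%:R * ln (126%:R : R).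
  by apply: ler_ln_natXM; lia.
have h2 : 28%:R * ln 126%:R + 8%:R * ln 65%:R <=
    5%:R * ln 833%:R + 28%:R * ln (125%:R : R).
  by apply: ler_ln_natXM; lia.
(* 28 times [h1] plus [h2]: the logarithms of 125 and 126 cancel. *)
lra.
Qed.

(** Since 833 = 7^2 * 17, [gamma] is 1/2 + log_65(833)/6, and the claim becomes 1.611 <= ln 833 / ln
    65 < 1.6116; the fractions 820/509 and 29/18 lie in this range. *)
Lemma gamma_bounds : 7685 / 10 ^+ 4 <= gamma R < 7686 / 10 ^+ 4.
Proof.
have := ln65_gt0; have := gamma_ln65; have := ln833_ge; have := ln833_lt.
rewrite ln833; move: (ln 65%:R) (ln 7%:R) (ln 17%:R) (gamma R) => L A B g.
move=> h1 h2 h3 L0; apply/andP; split.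
  by rewrite -(ler_pM2r L0) h3; lra.
by rewrite -(ltr_pM2r L0) h3; lra.
Qed.

(** Applying ln t < t to t = d * x lets a logarithmic error be absorbed into an arbitrarily small
    linear one. *)
Lemma ln_le_linear (d x : R) : 0 < d -> 0 < x -> ln x <= d * x + `|ln d|.
Proof.
move=> d0 x0; have dx0 : 0 < d * x by rewrite mulr_gt0.
have := ln_sublinear dx0; rewrite lnM ?posrE //.
by have := lerNnormlW (lexx `|ln d|); lra.
Qed.

Lemma ln_size_digitset (d : R) (n : nat) : 0 < d ->
  gamma R * ln 65%:R * n%:R - d * n%:R - `|ln d| - ln 2%:R - ln 17%:R
    <= ln (size (digitset n.+1))%:R.
Proof.
move=> d0; set l := (trunc_log 2 n).+1.
have lE : l%:R * ln (2%:R : R) <= d * n%:R + `|ln d| + ln 2%:R.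
  rewrite /l -natr1 mulrDl mul1r lerD2r.
  case: n {l} => [|n]; first by rewrite trunc_log0 mul0r mulr0 add0r.
  apply: le_trans (ln_le_linear d0 _); last by rewrite ltr0n.
  by rewrite -ln_natX // ler_ln_nat ?expn_gt0 // trunc_logP.
have [P1 P2] : (3 * nval_odd n <= n + l)%N /\ (n <= 3 * nval_odd n + l)%N.
  exact/nval_odd_bound/trunc_log_ltn.
have le : (nval_odd n <= n %/ 2)%N by have [-> _] := nval_odd_half n; lia.
rewrite size_digitsetS !ln_natM ?muln_gt0 ?expn_gt0 // !ln_natX // gamma_ln65.
have c1 : n%:R / 2 <= (n - n %/ 2)%N%:R :> R.
  by rewrite ler_pdivrMr ?ltr0n // -natrM ler_nat; lia.
have c2 : n%:R <= ((n %/ 2 - nval_odd n)%N%:R + (nval_odd n)%:R) * 2 + 1 :> R.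
  by rewrite -natrD -natrM natr1 ler_nat; lia.
have c3 : 3 * (nval_odd n)%:R <= n%:R + l%:R :> R by rewrite -natrM -natrD ler_nat.
have A0 : 0 <= ln (7%:R : R) by rewrite ln_ge0 // ler1n.
have AB : ln (7%:R : R) <= ln 17%:R by apply: ler_ln_nat.
(* From 17 <= 7 * 2^3: up to l/3 surplus positions with 7 digits instead of 17 cost at most l * ln
   2, which [lE] bounds. *)
have AB2 : ln (17%:R : R) <= ln 7%:R + 3 * ln 2%:R.
  by rewrite -ln_natX // -ln_natM //; apply: ler_ln_nat.
have L0 := ln65_gt0.
have l0 : 0 <= l%:R :> R by rewrite ler0n.
move: c1 c2 c3 A0 AB AB2 L0 lE l0.
move: (ln 65%:R) (ln 7%:R) (ln 17%:R) (ln 2%:R) (n%:R) (l%:R) => L A B T x y.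
move: ((n - n %/ 2)%N%:R) ((n %/ 2 - nval_odd n)%N%:R) ((nval_odd n)%:R) => o q p.
move=> c1 c2 c3 A0 AB AB2 L0 lE l0.
have h1 : 0 <= (o - x / 2) * L by rewrite mulr_ge0 //; lra.
have h2 : 0 <= ((q + p) * 2 + 1 - x) * B by rewrite mulr_ge0 //; lra.
have h3 : 0 <= (x + y - 3 * p) * (B - A) by rewrite mulr_ge0 //; lra.
have h4 : 0 <= y * (A + 3 * T - B) by rewrite mulr_ge0 //; lra.
lra.
Qed.

End RealBounds.

Theorem theorem1p1 (R : realType) :
  (7685 / 10 ^+ 4 <= gamma R < 7686 / 10 ^+ 4) /\
  forall eps : R, 0 < eps ->
    exists2 c : R, 0 < c &
      forall N : nat, (0 < N)%N ->
        exists A : {fset int},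
          [/\ forall a : int, a \in A -> 1 <= a <= N%:Z,
              ~ has_nontrivial_config A &
              c * (N%:R `^ (gamma R - eps)) <= #|` A|%fset%:R].
Proof.
split; first exact: gamma_bounds.
move=> eps eps0; have L0 := ln65_gt0 R.
have d0 : 0 < eps * ln (65%:R : R) by rewrite mulr_gt0.
(* With m = n + 1, position 0 is lost and N may approach 65^(n+2), hence two factors 65^gamma; the
   other terms come from [ln_size_digitset] with d = eps * ln 65. *)
pose K := 2 * (gamma R * ln 65%:R) + `|ln (eps * ln 65%:R)| + ln 2%:R + ln 17%:R.
exists (expR (- K)); first exact: expR_gt0.
move=> N N0; set m := trunc_log 65 N.
have mN : (65 ^ m <= N)%N by apply: trunc_logP.
have Nm : (N < 65 ^ m.+1)%N by apply: trunc_log_ltn.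
(* Configurations are translation invariant; the shift by 1 moves [0, 65^m) into [1, N]. *)
exists [fset x in [seq a.+1%:Z | a <- digitset m]]%fset; split.
- move=> a; rewrite inE => /mapP[b /digitset_lt bm ->]; lia.
- move=> [x [y [y0]]]; rewrite !inE.
  move=> /mapP[a am xa] /mapP[b bm yb] /mapP[c cm yc].
  by apply: (digitset_no_config am bm cm y0); lia.
rewrite card_fseq undup_id ?size_map; last first.
  by rewrite map_inj_uniq ?digitset_uniq // => a b; lia.
have g0 : 0 < gamma R by have /andP[+ _] := gamma_bounds R; lra.
have gL : 0 < gamma R * ln 65%:R by rewrite mulr_gt0.
have s0 : (0 < size (digitset m))%N.
  case: {mN Nm} m => [//|n]; rewrite size_digitsetS !muln_gt0 !expn_gt0 //.
have cN0 : 0 < expR (- K) * N%:R `^ (gamma R - eps).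
  by rewrite mulr_gt0 ?expR_gt0 ?powR_gt0 ?ltr0n.
rewrite -ler_ln ?posrE ?ltr0n // lnM ?posrE ?expR_gt0 ?powR_gt0 ?ltr0n //.
rewrite expRK ln_powR.
have lnN0 : m%:R * ln 65%:R <= ln (N%:R : R).
  by rewrite -ln_natX // ler_ln_nat ?expn_gt0.
have lnN1 : ln (N%:R : R) <= (m%:R + 1) * ln 65%:R.
  by rewrite natr1 -ln_natX // ler_ln_nat // ltnW.
have e1 : 0 <= gamma R * ((m%:R + 1) * ln 65%:R - ln N%:R).
  by rewrite mulr_ge0 //; lra.
have e2 : 0 <= eps * (ln N%:R - m%:R * ln 65%:R) by rewrite mulr_ge0 //; lra.
have t0 : 0 <= ln (2%:R : R) by rewrite ln_ge0 // ler1n.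
have B0 : 0 <= ln (17%:R : R) by rewrite ln_ge0 // ler1n.
have D0 := normr_ge0 (ln (eps * ln 65%:R)).
(* For m = 0 the set is {1}, and [K] covers all N < 65. *)
case: {mN Nm lnN0 lnN1 cN0 s0} m e1 e2 => [|n] e1 e2.
  by rewrite /= ln1 /K; lra.
have := ln_size_digitset n d0; rewrite /K -(natr1 n) in e1 e2 *; lra.
Qed.
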